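(* Let $p$ be a prime. (i) Let $Q\in\mathcal A_p$. Then there is an epimorphism $\varphi:F_p\to Q$ with $\ker\varphi\le Z(F_p)$. (ii) Let $Q_1,Q_2\in\mathcal A_p$, and let $\varphi_i:F_p\to Q_i$ ($i=1,2$) be epimorphisms as provided by (i), with $\ker\varphi_i\le Z(F_p)$. Then $Q_1\cong Q_2$ if and only if there is $\rho\in\mathrm{GL}_2(p)$ such that $\ker\varphi_2=\widehat\rho(\ker\varphi_1)$.
   Context: A loop is automorphic if all its inner mappings (the group generated by $L_{yx}^{-1}L_yL_x$, $R_{xy}^{-1}R_yR_x$, $L_x^{-1}R_x$, with $L_x(y)=xy$, $R_x(y)=yx$) are automorphisms. $\mathcal A_p$ is the class of all $2$-generated commutative automorphic loops $Q$ possessing a central subloop $Z\cong\mathbb Z_p$ such that $Q/Z\cong\mathbb Z_p\times\mathbb Z_p$. Elements of $\mathbb Z_p$ are identified with the integers $0,\dots,p-1$. For $0\le a,b<p$ let $(a,b)_p=0$ if $a+b<p$ and $(a,b)_p=1$ otherwise. $F_p$ is the commutative automorphic loop on $(\mathbb Z_p)^6$ with multiplication $$(a_1,\dots,a_6)(b_1,\dots,b_6)=(a_1+b_1,\ a_2+b_2,\ a_3+b_3+(a_1,b_1)_p,\ a_4+b_4+(a_2,b_2)_p,\ a_5+b_5-a_1b_1(a_2+b_2),\ a_6+b_6+a_2b_2(a_1+b_1)).$$ It is generated by $x=(1,0,0,0,0,0)$ and $y=(0,1,0,0,0,0)$, and its center is $Z(F_p)=0\times0\times(\mathbb Z_p)^4$.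 For $\rho=\begin{pmatrix}\alpha_1&\alpha_2\\ \beta_1&\beta_2\end{pmatrix}\in\mathrm{GL}_2(p)$, $\widehat\rho$ denotes the automorphism of $F_p$ determined by $\widehat\rho(x)=(\alpha_1,\alpha_2,0,0,0,0)=x^{\alpha_1}y^{\alpha_2}$ and $\widehat\rho(y)=(\beta_1,\beta_2,0,0,0,0)=x^{\beta_1}y^{\beta_2}$. *)

(* Defs.v *)
From HB Require Import structures.
From mathcomp Require Import all_boot all_order all_algebra all_fingroup.
From mathcomp Require Import all_classical.

Set Implicit Arguments.
Unset Strict Implicit.
Unset Printing Implicit Defensive.

Import GroupScope GRing.Theory.
Local Open Scope group_scope.
Local Open Scope classical_set_scope.

(* ldiv x y is the z with x * z = y, that is L_x^{-1}(y);
   rdiv y x is the z with z * x = y, that is R_x^{-1}(y). *)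
HB.mixin Record UMagma_isLoop Q of UMagma Q := {
  ldiv : Q -> Q -> Q;
  rdiv : Q -> Q -> Q;
  loop_mulKl : forall x : Q, cancel (mul x) (ldiv x);
  loop_ldivKl : forall x : Q, cancel (ldiv x) (mul x);
  loop_mulKr : forall x : Q, cancel (mul ^~ x) (rdiv ^~ x);
  loop_rdivKr : forall x : Q, cancel (rdiv ^~ x) (mul ^~ x)
}.

#[short(type="loopType")]
HB.structure Definition Loop := {Q of UMagma_isLoop Q & UMagma Q}.

Section MagmaMorphisms.
Variables G H : magmaType.

Definition isomorphic : Prop :=
  exists f : {multiplicative G -> H}, bijective f.

Definition epimorphism (f : {multiplicative G -> H}) : Prop :=
  forall y, exists x, f x = y.

Definition automorphism (f : G -> G) : Prop :=
  bijective f /\ {morph f : x y / x * y}.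

End MagmaMorphisms.

Definition loop_ker (Q R : loopType) (f : {multiplicative Q -> R}) : set Q :=
  [set x | f x = 1].

Section LoopNotions.
Variable Q : loopType.
Implicit Types (x y z : Q) (Z : set Q).

Inductive inner_mapping : (Q -> Q) -> Prop :=
| inner_L x y : inner_mapping (fun z => ldiv (y * x) (y * (x * z)))
| inner_R x y : inner_mapping (fun z => rdiv ((z * x) * y) (x * y))
| inner_T x : inner_mapping (fun z => ldiv x (z * x))
| inner_id : inner_mapping id
| inner_comp f g : inner_mapping f -> inner_mapping g -> inner_mapping (f \o g)
| inner_inv f g : cancel f g -> cancel g f ->
    inner_mapping f -> inner_mapping g.

Definition automorphic : Prop :=
  forall f, inner_mapping f -> automorphism f.

Definition subloop Z : Prop :=
  [/\ Z 1,
      forall x y, Z x -> Z y -> Z (x * y),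
      forall x y, Z x -> Z y -> Z (ldiv x y)
    & forall x y, Z x -> Z y -> Z (rdiv x y)].

Definition two_generated : Prop :=
  exists x y, smallest subloop [set x; y] = setT.

Definition center : set Q :=
  [set z | forall x y,
    [/\ z * x = x * z,
        z * (x * y) = (z * x) * y,
        x * (z * y) = (x * z) * y
      & x * (y * z) = (x * y) * z]].

Definition central_subloop Z : Prop := subloop Z /\ Z `<=` center.

End LoopNotions.
Arguments center : clear implicits.

Section Subloop.
Variables (Q : loopType) (Z : set Q) (subZ : subloop Z).

Definition subloop_type of subloop Z : Type := set_type Z.
Local Notation S := (subloop_type subZ).

HB.instance Definition _ := Choice.copy S (set_type Z).

Let in_Z (x : S) : Z (val x).
Proof. exact: set_mem (valP x). Qed.

Let mkS x (Zx : Z x) : S := exist _ x (mem_set Zx).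

Definition subloop_one : S :=
  mkS (let: And4 Z1 _ _ _ := subZ in Z1).
Definition subloop_mul (x y : S) : S :=
  mkS (let: And4 _ ZM _ _ := subZ in ZM _ _ (in_Z x) (in_Z y)).
Definition subloop_ldiv (x y : S) : S :=
  mkS (let: And4 _ _ ZL _ := subZ in ZL _ _ (in_Z x) (in_Z y)).
Definition subloop_rdiv (x y : S) : S :=
  mkS (let: And4 _ _ _ ZR := subZ in ZR _ _ (in_Z x) (in_Z y)).

HB.instance Definition _ := hasMul.Build S subloop_mul.

Let mul1 : left_id subloop_one (@mul S).
Proof. by move=> x; apply: val_inj; apply: mul1g. Qed.
Let mulr1 : right_id subloop_one (@mul S).
Proof. by move=> x; apply: val_inj; apply: mulg1. Qed.
HB.instance Definition _ := Magma_isUMagma.Build S mul1 mulr1.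

Let loop_mulKl (x : S) : cancel (mul x) (subloop_ldiv x).
Proof. by move=> y; apply: val_inj; apply: loop_mulKl. Qed.
Let loop_ldivKl (x : S) : cancel (subloop_ldiv x) (mul x).
Proof. by move=> y; apply: val_inj; apply: loop_ldivKl. Qed.
Let loop_mulKr (x : S) : cancel (mul ^~ x) (subloop_rdiv ^~ x).
Proof. by move=> y; apply: val_inj; apply: loop_mulKr. Qed.
Let loop_rdivKr (x : S) : cancel (subloop_rdiv ^~ x) (mul ^~ x).
Proof. by move=> y; apply: val_inj; apply: loop_rdivKr. Qed.
HB.instance Definition _ := UMagma_isLoop.Build S loop_mulKl loop_ldivKl loop_mulKr loop_rdivKr.

End Subloop.

(* The quotient of Q by a central subloop Z: its elements are the cosets
   x Z, multiplied and divided as complexes. *)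
Section Quotient.
Variables (Q : loopType) (Z : set Q) (cZ : central_subloop Z).

Definition zcoset (x : Q) : set Q := [set x * z | z in Z].

Definition quotient_type of central_subloop Z : Type := set_type (range zcoset).
Local Notation QZ := (quotient_type cZ).

HB.instance Definition _ := Choice.copy QZ (set_type (range zcoset)).

Let mkQ (x : Q) : QZ := exist _ (zcoset x) (mem_set (imageT zcoset x)).

Let mkQP (A : QZ) : exists x, A = mkQ x.
Proof.
case: (set_mem (valP A)) => x _ xA.
by exists x; apply: val_inj; rewrite /= xA.
Qed.

Definition complex_op (op : Q -> Q -> Q) (A B : set Q) : set Q :=
  [set op a b | a in A & b in B].

Let subZ : subloop Z := proj1 cZ.

Let Z1 : Z 1. Proof. by case: subZ. Qed.
Let ZM x y : Z x -> Z y -> Z (x * y). Proof. by case: subZ => _ H _ _; apply: H. Qed.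
Let ZL x y : Z x -> Z y -> Z (ldiv x y).
Proof. by case: subZ => _ _ H _; apply: H. Qed.

Let ZC z x : Z z -> z * x = x * z.
Proof. by case: cZ => _ sZ /sZ /(_ x x)[]. Qed.
Let ZAl z x y : Z z -> z * (x * y) = z * x * y.
Proof. by case: cZ => _ sZ /sZ /(_ x y)[]. Qed.
Let ZAm z x y : Z z -> x * (z * y) = x * z * y.
Proof. by case: cZ => _ sZ /sZ /(_ x y)[]. Qed.
Let ZAr z x y : Z z -> x * (y * z) = x * y * z.
Proof. by case: cZ => _ sZ /sZ /(_ x y)[]. Qed.

Let mulZZ x y u v : Z u -> Z v -> (x * u) * (y * v) = (x * y) * (u * v).
Proof.
move=> Zu Zv.
by rewrite (ZAr _ _ Zv) -(ZAm _ _ Zu) (ZC _ Zu) (ZAr _ _ Zu) (ZAr _ _ Zv).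
Qed.

Let complex_mulE x y : complex_op mul (zcoset x) (zcoset y) = zcoset (x * y).
Proof.
apply/seteqP; split=> [_ [_ [u Zu <-] [_ [v Zv <-] <-]]|_ [u Zu <-]].
  by exists (u * v); [exact: ZM | rewrite (mulZZ _ _ Zu Zv)].
exists (x * 1); first by exists 1.
by exists (y * u); [exists u | rewrite (mulZZ _ _ Z1 Zu) mul1g].
Qed.

Let complex_ldivE x y : complex_op ldiv (zcoset x) (zcoset y) = zcoset (ldiv x y).
Proof.
apply/seteqP; split=> [_ [_ [u Zu <-] [_ [v Zv <-] <-]]|_ [u Zu <-]].
  exists (ldiv u v); first exact: ZL.
  apply: (can_inj (loop_mulKl (x * u))).
  by rewrite loop_ldivKl (mulZZ _ _ Zu (ZL Zu Zv)) !loop_ldivKl.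
exists (x * 1); first by exists 1.
exists (y * u); first by exists u.
by apply: (can_inj (loop_mulKl (x * 1))); rewrite loop_ldivKl (mulZZ _ _ Z1 Zu) mul1g loop_ldivKl.
Qed.

Let complex_rdivE y x : complex_op rdiv (zcoset y) (zcoset x) = zcoset (rdiv y x).
Proof.
apply/seteqP; split=> [_ [_ [v Zv <-] [_ [u Zu <-] <-]]|_ [u Zu <-]].
  exists (ldiv u v); first exact: ZL.
  apply: (can_inj (loop_mulKr (x * u))).
  by rewrite loop_rdivKr (mulZZ _ _ (ZL Zu Zv) Zu) loop_rdivKr -(ZC _ Zu) loop_ldivKl.
exists (y * u); first by exists u.
exists (x * 1); first by exists 1.
by apply: (can_inj (loop_mulKr (x * 1))); rewrite loop_rdivKr (mulZZ _ _ Zu Z1) mulg1 loop_rdivKr.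
Qed.

Let complex_in op op' :
  (forall x y, complex_op op (zcoset x) (zcoset y) = zcoset (op' x y)) ->
  forall A B : QZ, complex_op op (val A) (val B) \in range zcoset.
Proof.
move=> opE A B; have [x ->] := mkQP A; have [y ->] := mkQP B.
by rewrite opE; apply/mem_set/imageT.
Qed.

Definition quotient_one : QZ := mkQ 1.
Definition quotient_mul (A B : QZ) : QZ :=
  exist _ (complex_op mul (val A) (val B)) (complex_in complex_mulE A B).
Definition quotient_ldiv (A B : QZ) : QZ :=
  exist _ (complex_op ldiv (val A) (val B)) (complex_in complex_ldivE A B).
Definition quotient_rdiv (A B : QZ) : QZ :=
  exist _ (complex_op rdiv (val A) (val B)) (complex_in complex_rdivE A B).

HB.instance Definition _ := hasMul.Build QZ quotient_mul.

Let mkM x y : mkQ x * mkQ y = mkQ (x * y).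
Proof. by apply: val_inj; apply: complex_mulE. Qed.
Let mkL x y : quotient_ldiv (mkQ x) (mkQ y) = mkQ (ldiv x y).
Proof. by apply: val_inj; apply: complex_ldivE. Qed.
Let mkR x y : quotient_rdiv (mkQ x) (mkQ y) = mkQ (rdiv x y).
Proof. by apply: val_inj; apply: complex_rdivE. Qed.

Let mul1 : left_id quotient_one (@mul QZ).
Proof. by move=> A; have [x ->] := mkQP A; rewrite mkM mul1g. Qed.
Let mulr1 : right_id quotient_one (@mul QZ).
Proof. by move=> A; have [x ->] := mkQP A; rewrite mkM mulg1. Qed.
HB.instance Definition _ := Magma_isUMagma.Build QZ mul1 mulr1.

Let qmulKl (A : QZ) : cancel (mul A) (quotient_ldiv A).
Proof.
by move=> B; have [x ->] := mkQP A; have [y ->] := mkQP B; rewrite mkM mkL loop_mulKl.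
Qed.
Let qldivKl (A : QZ) : cancel (quotient_ldiv A) (mul A).
Proof.
by move=> B; have [x ->] := mkQP A; have [y ->] := mkQP B; rewrite mkL mkM loop_ldivKl.
Qed.
Let qmulKr (A : QZ) : cancel (mul ^~ A) (quotient_rdiv ^~ A).
Proof.
move=> B; have [x ->] := mkQP A; have [y ->] := mkQP B.
by rewrite mkM mkR; congr mkQ; apply: loop_mulKr.
Qed.
Let qrdivKr (A : QZ) : cancel (quotient_rdiv ^~ A) (mul ^~ A).
Proof.
move=> B; have [x ->] := mkQP A; have [y ->] := mkQP B.
by rewrite mkR mkM; congr mkQ; apply: loop_rdivKr.
Qed.
HB.instance Definition _ :=
  UMagma_isLoop.Build QZ qmulKl qldivKl qmulKr qrdivKr.

End Quotient.

(* 'F_p and 'F_p * 'F_p are used here through their group structures, whose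
   operation is addition modulo p. *)
Definition in_class_A (p : nat) (Q : loopType) : Prop :=
  [/\ two_generated Q,
      commutative (@mul Q),
      automorphic Q
    & exists (Z : set Q) (cZ : central_subloop Z),
        isomorphic (subloop_type (proj1 cZ)) 'F_p /\
        isomorphic (quotient_type cZ) ('F_p * 'F_p)%type].

Local Open Scope ring_scope.

(* For p prime, the elements of 'F_p coerce to the integers 0, ..., p - 1. *)
Definition carry (p : nat) (a b : 'F_p) : 'F_p :=
  if (a + b < p)%N then 0 else 1.

(* The primality argument is what makes 'F_p have p elements; without it
   (0, ..., 0) need not be neutral. *)
Definition Floop (p : nat) of prime p : Type :=
  ('F_p * 'F_p * 'F_p * 'F_p * 'F_p * 'F_p)%type.

Section Floop.
Variables (p : nat) (p_pr : prime p).
Local Notation F := (Floop p_pr).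

HB.instance Definition _ :=
  Finite.copy F ('F_p * 'F_p * 'F_p * 'F_p * 'F_p * 'F_p)%type.

Definition Fmul (a b : F) : F :=
  let: (a1, a2, a3, a4, a5, a6) := a in
  let: (b1, b2, b3, b4, b5, b6) := b in
  (a1 + b1,
   a2 + b2,
   a3 + b3 + carry a1 b1,
   a4 + b4 + carry a2 b2,
   a5 + b5 - a1 * b1 * (a2 + b2),
   a6 + b6 + a2 * b2 * (a1 + b1)).

Definition Fone : F := (0, 0, 0, 0, 0, 0).

Definition Fdiv (a c : F) : F :=
  let: (a1, a2, a3, a4, a5, a6) := a in
  let: (c1, c2, c3, c4, c5, c6) := c in
  (c1 - a1,
   c2 - a2,
   c3 - a3 - carry a1 (c1 - a1),
   c4 - a4 - carry a2 (c2 - a2),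
   c5 - a5 + a1 * (c1 - a1) * c2,
   c6 - a6 - a2 * (c2 - a2) * c1).

Let carryC (a b : 'F_p) : carry a b = carry b a.
Proof. by rewrite /carry addnC. Qed.

Let carry0 (a : 'F_p) : carry 0 a = 0.
Proof.
by rewrite /carry /= add0n; have := ltn_ord a; rewrite [X in (_ < X)%N]Fp_cast // => ->.
Qed.

HB.instance Definition _ := hasMul.Build F Fmul.

Let FmulC : commutative (@mul F).
Proof.
move=> [[[[[a1 a2] a3] a4] a5] a6] [[[[[b1 b2] b3] b4] b5] b6].
rewrite /mul /= (carryC a1) (carryC a2) (mulrC a1) (mulrC a2).
by rewrite (addrC a1) (addrC a2) (addrC a3) (addrC a4) (addrC a5) (addrC a6).
Qed.

Let Fmul1 : left_id Fone (@mul F).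
Proof.
move=> [[[[[a1 a2] a3] a4] a5] a6].
by rewrite /mul /= !carry0 !mul0r subr0 !add0r !addr0.
Qed.
Let Fmulr1 : right_id Fone (@mul F).
Proof. by move=> a; rewrite FmulC Fmul1. Qed.
HB.instance Definition _ := Magma_isUMagma.Build F Fmul1 Fmulr1.

Let FmulK (a : F) : cancel (mul a) (Fdiv a).
Proof.
case: a => [[[[[a1 a2] a3] a4] a5] a6] [[[[[b1 b2] b3] b4] b5] b6].
rewrite /mul /= ![a1 + b1 - a1]addrAC ![a2 + b2 - a2]addrAC !subrr !add0r.
congr (_, _, _, _, _, _).
- by rewrite [_ - a3]addrAC [a3 + b3 - a3]addrAC subrr add0r addrK.
- by rewrite [_ - a4]addrAC [a4 + b4 - a4]addrAC subrr add0r addrK.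
- by rewrite [_ - a5]addrAC [a5 + b5 - a5]addrAC subrr add0r subrK.
- by rewrite [_ - a6]addrAC [a6 + b6 - a6]addrAC subrr add0r addrK.
Qed.

Let FdivK (a : F) : cancel (Fdiv a) (mul a).
Proof.
case: a => [[[[[a1 a2] a3] a4] a5] a6] [[[[[b1 b2] b3] b4] b5] b6].
rewrite /mul /= ![a1 + (b1 - a1)]addrC ![a2 + (b2 - a2)]addrC !subrK.
congr (_, _, _, _, _, _).
- by rewrite addrA subrK addrC subrK.
- by rewrite addrA subrK addrC subrK.
- by rewrite addrA addrK addrC subrK.
- by rewrite addrA subrK addrC subrK.
Qed.

Let FmulKr (a : F) : cancel (mul ^~ a) (fun c => Fdiv a c).
Proof. by move=> b; rewrite /= FmulC FmulK. Qed.
Let FdivKr (a : F) : cancel (fun c => Fdiv a c) (mul ^~ a).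
Proof. by move=> b; rewrite /= FmulC FdivK. Qed.
HB.instance Definition _ :=
  @UMagma_isLoop.Build F Fdiv (fun c a => Fdiv a c) FmulK FdivK FmulKr FdivKr.

Definition Fx : F := (1, 0, 0, 0, 0, 0).
Definition Fy : F := (0, 1, 0, 0, 0, 0).

(* "h is the automorphism hat rho"; h is unique since Fx and Fy generate F. *)
Definition is_hat (rho : {'GL_2(p)}) (h : F -> F) : Prop :=
  [/\ automorphism h,
      h Fx = (GLval rho 0 0, GLval rho 0 1, 0, 0, 0, 0)
    & h Fy = (GLval rho 1 0, GLval rho 1 1, 0, 0, 0, 0)].

End Floop.

(* Main.v *)
Require Import Defs.
From HB Require Import structures.
From mathcomp Require Import all_boot all_order all_algebra all_fingroup.
From mathcomp Require Import all_classical.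
From mathcomp Require Import ring.

(** Every Q in the class is a central extension of a plane over Z_p by a line
    over Z_p, and what makes such a commutative loop automorphic is visible in
    its associator A, defined by (xy)z = x(yz) A(x,y,z).  The associator takes
    central values, and the inner mapping z |-> (yx)\(y(xz)) is
    multiplication by the inverse of A(y,x,z); it is an automorphism exactly
    when A is additive in its last argument.  Commutativity gives
    A(z,y,x) = -A(x,y,z) and a cyclic identity, hence additivity in all three
    arguments ([assocDl], [assocDm]).  A trilinear form with these symmetries
    on a plane spanned by x and y is determined by A(x,x,y) and A(x,y,y), and
    expanding a product of two elements x^a y^b with it ([mul_powers]) yields
    exactly the correction terms a1 b1 (a2 + b2) and a2 b2 (a1 + b1) of the
    loop F_p; the carries record x^p and y^p.  So F_p maps to Q, sending its two
    generators to any two prescribed elements ([Floop_free]).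

    F_p itself is an extension of the same kind, of Z_p^2 by Z_p^4.  Thus
    [Floop_free] applies both to Q, which gives (i), and to F_p, which gives
    enough endomorphisms for (ii).  The notion [trilinear_ext] covers both
    uses.

    (i) Taking generators of Q for the images, the map is onto.  Modulo the
    centre it is a linear map from Z_p^2 onto Z_p^2, so it is injective there,
    and its kernel lies in the centre.

    (ii) An automorphism of F_p that carries one kernel to the other induces
    an isomorphism of the quotients.  Conversely, an isomorphism f lifts to an
    endomorphism h of F_p with phi2 h = f phi1, by freeness.  Its linear part
    rho is invertible, but h may differ from hat rho by central factors on the
    generators.  This does not affect the kernels: the ratio of two
    endomorphisms with the same linear part is a homomorphism from F_p to the
    elementary abelian group Z_p^4, and such homomorphisms depend on the first
    two coordinates only ([Floop_additive]), so h and hat rho agree on the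
    centre ([Floop_morph_center]). *)

Set Implicit Arguments.
Unset Strict Implicit.
Unset Printing Implicit Defensive.

Import GroupScope GRing.Theory.
Local Open Scope group_scope.
Local Open Scope classical_set_scope.

(** * Loops and their homomorphisms *)

Section MkMultiplicative.
Variables (G H : magmaType) (f : G -> H) (fM : {morph f : x y / x * y}).

Definition mk_multiplicative : {multiplicative G -> H} :=
  HB.pack f (isMultiplicative.Build G H f fM).

End MkMultiplicative.

Section LoopBasics.
Variable Q : loopType.

Lemma loop_mulIl (x : Q) : injective (mul x).
Proof. exact: can_inj (loop_mulKl x). Qed.

Lemma loop_mulIr (x : Q) : injective (mul ^~ x).
Proof. exact: can_inj (loop_mulKr x). Qed.

Lemma mul_center (x y u v : Q) : center Q u -> center Q v ->
  (x * u) * (y * v) = (x * y) * (u * v).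
Proof.
move=> cu cv; have [_ _ _ ->] := cv (x * u) y; have [_ _ <- _] := cu x y.
have [uy _ _ _] := cu y y; rewrite uy.
by have [_ _ _ ->] := cu x y; have [_ _ _ ->] := cv (x * y) u.
Qed.

Lemma generated_ind (x y : Q) (S : set Q) : smallest (@subloop Q) [set x; y] = setT ->
  subloop S -> S x -> S y -> forall q, S q.
Proof.
move=> gen subS Sx Sy q.
have sub_xyS : [set x; y] `<=` S by move=> _ [] ->.
by have /(_ q) := smallest_sub subS sub_xyS; rewrite gen; apply.
Qed.

End LoopBasics.

Section LoopMorphisms.
Variables Q R : loopType.
Implicit Types f g : {multiplicative Q -> R}.

Lemma loop_morph1 f : f 1 = 1.
Proof. by apply: (@loop_mulIl _ (f 1)); rewrite -gmulfM !mulg1. Qed.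

Lemma loop_morph_ldiv f x y : f (ldiv x y) = ldiv (f x) (f y).
Proof. by apply: (@loop_mulIl _ (f x)); rewrite -gmulfM !loop_ldivKl. Qed.

Lemma loop_morph_rdiv f x y : f (rdiv x y) = rdiv (f x) (f y).
Proof.
apply: (@loop_mulIr _ (f y)); rewrite loop_rdivKr -gmulfM.
by congr (f _); exact: loop_rdivKr.
Qed.

Lemma loop_morph_eqE f x y : f x = f y -> loop_ker f (ldiv x y).
Proof.
move=> fxy; rewrite /loop_ker /= loop_morph_ldiv.
by apply: (@loop_mulIl _ (f x)); rewrite loop_ldivKl mulg1.
Qed.

Lemma subloop_equalizer f g : subloop [set x | f x = g x].
Proof.
split=> [|x y /= fx fy|x y /= fx fy|x y /= fx fy].
- by rewrite /= !loop_morph1.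
- by rewrite !gmulfM fx fy.
- by rewrite !loop_morph_ldiv fx fy.
- by rewrite !loop_morph_rdiv fx fy.
Qed.

Lemma subloop_range f : subloop (range f).
Proof.
split.
- by exists 1 => //; exact: loop_morph1.
- by move=> _ _ [x _ <-] [y _ <-]; exists (x * y) => //; exact: gmulfM.
- by move=> _ _ [x _ <-] [y _ <-]; exists (ldiv x y) => //; exact: loop_morph_ldiv.
- by move=> _ _ [x _ <-] [y _ <-]; exists (rdiv x y) => //; exact: loop_morph_rdiv.
Qed.

Lemma loop_morph_inj f : (forall x, f x = 1 -> x = 1) -> injective f.
Proof.
move=> f1 x y fxy; rewrite -[y](loop_ldivKl x).
suff -> : ldiv x y = 1 by rewrite mulg1.
apply: f1; apply: (can_inj (loop_mulKl (f x))).
by rewrite -gmulfM loop_ldivKl mulg1 fxy.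
Qed.

Lemma center_inj_morph (f : {multiplicative Q -> R}) (z : Q) :
  injective f -> center R (f z) -> center Q z.
Proof.
move=> f_inj cz x y; have [zC zl zm zr] := cz (f x) (f y).
by split; apply: f_inj; rewrite !gmulfM.
Qed.

Lemma inj_epi_isomorphic (f : {multiplicative Q -> R}) :
  injective f -> epimorphism f -> isomorphic Q R.
Proof.
move=> f_inj f_epi; exists f; pose g y := projT1 (cid (f_epi y)).
have fg : cancel g f by move=> y; rewrite /g; case: cid.
by exists g => // q; apply: f_inj; rewrite fg.
Qed.

End LoopMorphisms.

(** * Commutative loops with a trilinear associator *)

(** The features of a central extension of W by V, both elementary abelian
    p-groups written additively, on which the calculus of associators rests.
    Recording the embedding of V and the associator as functions turns identities
    between central factors into identities in the vector space V. *)
Record trilinear_ext (p : nat) (Q : loopType) (V W : lmodType 'F_p) := TrilinearExt {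
  ext_mulC : commutative (@mul Q);
  emb : V -> Q;
  embD : forall u v, emb (u + v)%R = emb u * emb v;
  emb_inj : injective emb;
  emb_center : forall v, center Q (emb v);
  proj : Q -> W;
  projM : forall x y, proj (x * y) = (proj x + proj y)%R;
  proj_ker : forall x, proj x = 0%R -> exists v, x = emb v;
  assoc : Q -> Q -> Q -> V;
  assocE : forall x y z, (x * y) * z = (x * (y * z)) * emb (assoc x y z);
  assocDr : forall x y z t,
    assoc x y (z * t) = (assoc x y z + assoc x y t)%R
}.

Section CarryNat.
Variables (p : nat) (p_pr : prime p).

Lemma carryE (a b : 'F_p) : carry a b = ((a + b) %/ p)%:R%R.
Proof.
have lt_p (c : 'F_p) : (c < p)%N by rewrite -[X in (_ < X)%N](Fp_cast p_pr).
rewrite /carry; case: ltnP => [ltab|leab]; first by rewrite divn_small.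
suff -> : ((a + b) %/ p = 1)%N by [].
apply/eqP; rewrite eqn_leq divn_gt0 ?prime_gt0 // leab andbT.
by rewrite -ltnS ltn_divLR ?prime_gt0 // mul2n -addnn -addSn leq_add // ltnW.
Qed.

(** Adding two natural numbers in base p: the carry is what the quotients by p
    miss. *)
Lemma carry_nat m n :
  ((m %/ p)%:R + (n %/ p)%:R + carry (m%:R : 'F_p) n%:R = ((m + n) %/ p)%:R :> 'F_p)%R.
Proof.
rewrite carryE !val_Fp_nat // -!natrD; congr (_%:R)%R.
rewrite {3}(divn_eq m p) {3}(divn_eq n p) addnACA -mulnDl divnMDl ?prime_gt0 //.
Qed.

(** Both sides equal the quotient by p of the integer a + b + c. *)
Lemma carry_cocycle (a b c : 'F_p) :
  (carry a b + carry (a + b) c = carry b c + carry a (b + c))%R.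
Proof.
have lt_p (d : 'F_p) : (d < p)%N by rewrite -[X in (_ < X)%N](Fp_cast p_pr).
have natK (d : 'F_p) : (d%:R = d :> 'F_p)%R by rewrite natr_Zp.
have H (d e g : 'F_p) : (carry d e + carry (d + e) g = ((d + e + g) %/ p)%:R)%R.
  rewrite -(carry_nat (d + e) g) natrD !natK (divn_small (lt_p g)) addr0.
  by rewrite carryE.
have -> : carry a (b + c)%R = carry (b + c)%R a by rewrite /carry [in RHS]addnC.
by rewrite !H; congr ((_ %/ p)%:R)%R; rewrite [in RHS]addnC addnA.
Qed.

End CarryNat.

Section ExtensionCalculus.
Variables (p : nat) (Q : loopType) (V W : lmodType 'F_p) (E : trilinear_ext Q V W).
Implicit Types (x y z t : Q) (u v : V).
Local Notation i := (emb E).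
Local Notation A := (assoc E).
Local Notation mulC := (ext_mulC E).

Lemma emb0 : i 0%R = 1.
Proof. by apply: (@loop_mulIl _ (i 0%R)); rewrite -embD addr0 mulg1. Qed.

Lemma mul_embD x u v : x * i u * i v = x * i (u + v)%R.
Proof. by rewrite embD; have [_ _ _ ->] := emb_center E v x (i u). Qed.

Lemma mul_embr x y v : x * (y * i v) = x * y * i v.
Proof. by have [_ _ _ ->] := emb_center E v x y. Qed.

Lemma mul_embl x y v : x * i v * y = x * y * i v.
Proof. by rewrite mulC mul_embr mulC [y * x]mulC mulC. Qed.

Lemma mul_emb x y u v : (x * i u) * (y * i v) = x * y * i (u + v)%R.
Proof. by rewrite mul_embr mul_embl mul_embD. Qed.

Lemma mul_emb_inj x : injective (fun v => x * i v).
Proof. by move=> u v /loop_mulIl /emb_inj. Qed.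

Lemma mul_emb_eq1 x v : x * i v = x -> v = 0%R.
Proof. by rewrite -[RHS]mulg1 -emb0 => /mul_emb_inj. Qed.

Local Notation mulA := (assocE E).

Let mul_rev x y z : x * (y * z) = z * y * x.
Proof. by rewrite mulC [y * z]mulC. Qed.

(** By commutativity x(yz) = (zy)x, so reversing the arguments of the associator
    undoes the reassociation. *)
Lemma assoc_anti x y z : A z y x = (- A x y z)%R.
Proof.
apply/eqP; rewrite -addr_eq0; apply/eqP.
apply: (@mul_emb_eq1 (x * y * z)).
by rewrite -mul_embD -{1}[x * y * z]mul_rev -(mulA z y x) -(mul_rev x y z) -mulA.
Qed.

(** Three reassociations, with commutativity in between, lead from (xy)z through
    (yz)x and (zx)y back to z(xy). *)
Lemma assoc_cyclic x y z : (A x y z + A y z x + A z x y = 0)%R.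
Proof.
apply: (@mul_emb_eq1 (z * (x * y))).
rewrite addrC -[(A x y z + _)%R]addrC addrA -2!mul_embD.
by rewrite -mulA [z * x * y]mulC -mulA [y * z * x]mulC -mulA mulC.
Qed.

Lemma assocDl x t y z : A (x * t) y z = (A x y z + A t y z)%R.
Proof. by rewrite assoc_anti assocDr opprD -!assoc_anti. Qed.

(** The cyclic identity expresses the middle argument through the outer ones. *)
Lemma assocDm x y t z : A x (y * t) z = (A x y z + A x t z)%R.
Proof.
have midE a b c : A a b c = (- A b c a - A c a b)%R.
  by apply/eqP; rewrite -subr_eq0 opprD !opprK addrA assoc_cyclic.
by rewrite midE assocDl assocDr !opprD addrACA -!midE.
Qed.

Lemma assoc_xyx x y : A x y x = 0%R.
Proof. by apply: (@mul_emb_eq1 (x * (y * x))); rewrite -mulA mul_rev. Qed.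

Lemma assocX1 x y z n : A (x ^+ n) y z = (n%:R *: A x y z)%R.
Proof.
elim: n => [|n IHn]; last by rewrite expgS assocDl IHn -natr1 scalerDl scale1r addrC.
by rewrite scale0r; apply: (addrI (A 1 y z)); rewrite -assocDl mulg1 addr0.
Qed.

Lemma assocX3 x y z n : A x y (z ^+ n) = (n%:R *: A x y z)%R.
Proof. by rewrite assoc_anti assocX1 -scalerN -assoc_anti. Qed.

Lemma assocX2 x y z n : A x (y ^+ n) z = (n%:R *: A x y z)%R.
Proof.
elim: n => [|n IHn]; last by rewrite expgS assocDm IHn -natr1 scalerDl scale1r addrC.
by rewrite scale0r; apply: (addrI (A x 1 z)); rewrite -assocDm mulg1 addr0.
Qed.

(** Powers of one element associate because A(x,x,x) = 0. *)
Lemma ext_expgD x m n : x ^+ (m + n) = x ^+ m * x ^+ n.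
Proof.
elim: m => [|m IHm]; first by rewrite expg0 mul1g.
rewrite addSn !expgS IHm mulA assocX2 assocX3 assoc_xyx !scaler0.
by rewrite emb0 mulg1.
Qed.

Section PrimeExponent.
Hypothesis p_pr : prime p.

Lemma expg_p_emb x : exists v, x ^+ p = i v.
Proof.
have piX n : proj E (x ^+ n) = (n%:R *: proj E x)%R.
  elim: n => [|n IHn]; last by rewrite expgS projM IHn -natr1 scalerDl scale1r addrC.
  by rewrite scale0r; apply: (addrI (proj E 1)); rewrite -projM mulg1 addr0.
by apply: (@proj_ker _ _ _ _ E); rewrite piX pchar_Fp_0 // scale0r.
Qed.

Lemma expg_divn x v m : x ^+ p = i v ->
  x ^+ m = x ^+ (m %% p) * i ((m %/ p)%:R *: v)%R.
Proof.
move=> xp; rewrite {1}(divn_eq m p) addnC ext_expgD; congr (_ * _).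
elim: (m %/ p)%N => [|k IHk]; first by rewrite scale0r emb0.
by rewrite mulSn ext_expgD xp IHk -embD -natr1 scalerDl scale1r addrC.
Qed.

(** Powers with exponents in Z_p, read as 0, ..., p - 1, multiply up to the carry;
    this is where the carries in the multiplication of F_p come from. *)
Lemma expg_Fp_add x v (a b : 'F_p) : x ^+ p = i v ->
  x ^+ a * x ^+ b = x ^+ (a + b)%R * i (carry a b *: v)%R.
Proof.
move=> xp; rewrite -ext_expgD (expg_divn _ xp) carryE //; congr (_ ^+ _ * _).
by rewrite -(val_Fp_nat p_pr) natrD !natr_Zp.
Qed.

End PrimeExponent.

(** The order of reassociation is (X Y)(X' Y') -> X (Y (X' Y')) -> X (X' (Y' Y))
    -> (X X')(Y Y'), with X, X' powers of x and Y, Y' powers of y; each step costs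
    one associator, and trilinearity reduces these to the two basic ones since
    A(x,y,x) = A(y,x,y) = 0. *)
Lemma mul_powers x y a b c d :
  (x ^+ a * y ^+ b) * (x ^+ c * y ^+ d) =
  (x ^+ a * x ^+ c) * (y ^+ b * y ^+ d) *
    i (- (a%:R * c%:R * (b%:R + d%:R)) *: A x x y +
       b%:R * d%:R * (a%:R + c%:R) *: A x y y)%R.
Proof.
have mulAV r s t : r * (s * t) = r * s * t * i (- A r s t)%R.
  by rewrite (mulA r) mul_embD subrr emb0 mulg1.
rewrite (mulA (x ^+ a)) [y ^+ b * (_ * _)]mulC (mulA (x ^+ c)) [y ^+ d * _]mulC.
rewrite mul_embr mulAV.
rewrite !mul_embD; congr (_ * _ * i _).
rewrite !assocDr !(assocX1, assocX2, assocX3) !assoc_xyx !scaler0.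
by rewrite add0r !scalerA -!scalerDl -scaleNr; congr (_ *: _ + _ *: _)%R; ring.
Qed.

End ExtensionCalculus.

Section FreeMap.
Variables (p : nat) (p_pr : prime p) (Q : loopType) (V W : lmodType 'F_p).
Variable E : trilinear_ext Q V W.
Local Notation F := (Floop p_pr).

(** The multiplication of F_p transcribes [mul_powers] and [expg_Fp_add], so x and
    y may be chosen freely. *)
Theorem Floop_free (x y : Q) :
  exists phi : {multiplicative F -> Q}, phi (Fx p_pr) = x /\ phi (Fy p_pr) = y.
Proof.
have [u xp] := expg_p_emb E p_pr x.
have [v yp] := expg_p_emb E p_pr y.
(* The images of the six coordinate directions: x and y, their p-th powers
   u and v, and the two basic associators. *)
pose phi (a : F) : Q := let: (a1, a2, a3, a4, a5, a6) := a in
  x ^+ a1 * y ^+ a2 *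
    emb E (a3 *: u + a4 *: v + a5 *: assoc E x x y + a6 *: assoc E x y y)%R.
have phiM : {morph phi : a b / a * b}.
  move=> [[[[[a1 a2] a3] a4] a5] a6] [[[[[b1 b2] b3] b4] b5] b6].
  rewrite /phi mul_emb (mul_powers E) (expg_Fp_add p_pr _ _ xp) (expg_Fp_add p_pr _ _ yp).
  rewrite mul_emb !mul_embD !natr_Zp /=; congr (_ * emb E _).
  rewrite !(scalerDl, scaleNr).
  (* Both sides are sums of twelve multiples of u, v and the two associators;
     the left one is grouped by vector, the right one by origin. *)
  by rewrite [LHS](AC (3*3*3*3) ((3*6)*((9*12)*((1*4*7*10)*(2*5*8*11))))).
exists (mk_multiplicative phiM).
by split; rewrite /= !scale0r !addr0 (emb0 E) !mulg1 ?mul1g.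
Qed.

End FreeMap.

(** * The loop F_p *)

(** The two vector spaces are named as modules over Z_p: a bare product of copies
    of Z_p carries several other scalar actions. *)
Definition Fp2 (p : nat) : lmodType 'F_p := (('F_p)^o * ('F_p)^o)%type.
Definition Fp4 (p : nat) : lmodType 'F_p :=
  (('F_p)^o * ('F_p)^o * ('F_p)^o * ('F_p)^o)%type.

Section FloopExt.
Variables (p : nat) (p_pr : prime p).
Local Notation F := (Floop p_pr).
Local Notation V := (Fp4 p).
Local Notation W := (Fp2 p).

Definition coord1 (a : F) : 'F_p := let: (a1, _, _, _, _, _) := a in a1.
Definition coord2 (a : F) : 'F_p := let: (_, a2, _, _, _, _) := a in a2.
Definition Floop_proj (a : F) : W := (coord1 a, coord2 a).

Definition Floop_emb (v : V) : F := let: (v3, v4, v5, v6) := v in (0, 0, v3, v4, v5, v6)%R.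

(** The middle argument times the determinant of the outer two. *)
Definition Floop_assoc (a b c : F) : V :=
  let: (a1, a2, _, _, _, _) := a in
  let: (b1, b2, _, _, _, _) := b in
  let: (c1, c2, _, _, _, _) := c in
  (0, 0, b1 * (a1 * c2 - a2 * c1), b2 * (a1 * c2 - a2 * c1))%R.

Let carryC (a b : 'F_p) : carry a b = carry b a.
Proof. by rewrite /carry addnC. Qed.

Let carry0 (a : 'F_p) : carry 0%R a = 0%R.
Proof.
by rewrite carryE // add0n divn_small // -[X in (_ < X)%N](Fp_cast p_pr).
Qed.

Lemma Floop_mulC : commutative (@mul F).
Proof.
move=> [[[[[a1 a2] a3] a4] a5] a6] [[[[[b1 b2] b3] b4] b5] b6].
rewrite /mul /= (carryC a1) (carryC a2).
congr (_, _, _, _, _, _); ring.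
Qed.

Lemma Floop_assocE (a b c : F) : (a * b) * c = a * (b * c) * Floop_emb (Floop_assoc a b c).
Proof.
case: a => [[[[[a1 a2] a3] a4] a5] a6].
case: b => [[[[[b1 b2] b3] b4] b5] b6].
case: c => [[[[[c1 c2] c3] c4] c5] c6].
have cE (x y z : 'F_p) := @carry_cocycle p p_pr x y z.
rewrite /mul /= 2!(carryC _ 0%R) !carry0.
congr (_, _, _, _, _, _).
- by ring.
- by ring.
- by rewrite [carry a1 (b1 + c1)%R](_ : _ = carry a1 b1 + carry (a1 + b1) c1 - carry b1 c1)%R;
    [ring | rewrite cE [(_ + carry _ (_ + _))%R]addrC addrK].
- by rewrite [carry a2 (b2 + c2)%R](_ : _ = carry a2 b2 + carry (a2 + b2) c2 - carry b2 c2)%R;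
    [ring | rewrite cE [(_ + carry _ (_ + _))%R]addrC addrK].
- by ring.
- by ring.
Qed.

Lemma Floop_assocDr (a b c d : F) :
  Floop_assoc a b (c * d) = (Floop_assoc a b c + Floop_assoc a b d)%R.
Proof.
case: a => [[[[[a1 a2] a3] a4] a5] a6].
case: b => [[[[[b1 b2] b3] b4] b5] b6].
case: c => [[[[[c1 c2] c3] c4] c5] c6].
case: d => [[[[[d1 d2] d3] d4] d5] d6].
rewrite /mul /=; congr (_, _, _, _); rewrite /=; ring.
Qed.

Lemma Floop_embD (u v : V) : Floop_emb (u + v)%R = Floop_emb u * Floop_emb v.
Proof.
case: u => [[[u1 u2] u3] u4]; case: v => [[[v1 v2] v3] v4].
rewrite /mul /= !carry0; congr (_, _, _, _, _, _); ring.
Qed.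

Lemma Floop_emb_inj : injective Floop_emb.
Proof. by move=> [[[u1 u2] u3] u4] [[[v1 v2] v3] v4] [-> -> -> ->]. Qed.

Lemma coord1M (a b : F) : coord1 (a * b) = (coord1 a + coord1 b)%R.
Proof.
by case: a => [[[[[a1 a2] a3] a4] a5] a6]; case: b => [[[[[b1 b2] b3] b4] b5] b6].
Qed.

Lemma coord2M (a b : F) : coord2 (a * b) = (coord2 a + coord2 b)%R.
Proof.
by case: a => [[[[[a1 a2] a3] a4] a5] a6]; case: b => [[[[[b1 b2] b3] b4] b5] b6].
Qed.

Lemma Floop_projM (a b : F) : Floop_proj (a * b) = (Floop_proj a + Floop_proj b)%R.
Proof. by rewrite /Floop_proj coord1M coord2M. Qed.

Lemma Floop_proj_ker (a : F) : Floop_proj a = 0%R -> exists v, a = Floop_emb v.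
Proof.
by case: a => [[[[[a1 a2] a3] a4] a5] a6] [-> ->]; exists (a3, a4, a5, a6).
Qed.

Lemma Floop_emb_center (v : V) : center F (Floop_emb v).
Proof.
have assoc0 (a b c : F) : Floop_assoc a b c = 0%R -> a * b * c = a * (b * c).
  by move=> abc; rewrite Floop_assocE abc; exact: mulg1.
case: v => [[[v3 v4] v5] v6] a b.
case: a => [[[[[a1 a2] a3] a4] a5] a6]; case: b => [[[[[b1 b2] b3] b4] b5] b6].
split; first exact: Floop_mulC.
- by symmetry; apply: assoc0; congr (_, _, _, _); ring.
- by symmetry; apply: assoc0; congr (_, _, _, _); ring.
- by symmetry; apply: assoc0; congr (_, _, _, _); ring.
Qed.

Definition Floop_ext : trilinear_ext F V W :=
  TrilinearExt Floop_mulC Floop_embD Floop_emb_inj Floop_emb_center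
    Floop_projM Floop_proj_ker Floop_assocE Floop_assocDr.

(** If a is central, then A(a,x,y) and A(a,y,x) vanish; up to sign, their
    nontrivial entries are the first two coordinates of a. *)
Lemma center_Floop (a : F) : center F a <-> Floop_proj a = 0%R.
Proof.
split=> [ca|/Floop_proj_ker[v ->]]; last exact: Floop_emb_center.
have assoc_xy (b c : F) : Floop_assoc a b c = 0%R.
  have [_ abc _ _] := ca b c.
  apply: (@mul_emb_eq1 _ _ _ _ Floop_ext (a * (b * c))).
  by rewrite -(assocE Floop_ext) abc.
have := congr1 (fun v : V => v.1.2) (assoc_xy (Fx p_pr) (Fy p_pr)).
have := congr1 (fun v : V => v.2) (assoc_xy (Fy p_pr) (Fx p_pr)).
case: a {ca assoc_xy} => [[[[[a1 a2] a3] a4] a5] a6] /= a20 a10.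
have -> : a1 = 0%R by rewrite -[RHS]a10; ring.
have -> : a2 = 0%R by rewrite -[RHS]oppr0 -[in RHS]a20; ring.
by [].
Qed.

(** Powers of x fill the first and third coordinates, because x^n has the last two
    base-p digits of n there; powers of y fill the second and fourth; associators
    fill the fifth and sixth. *)
Lemma Floop_generated (S : set F) :
  subloop S -> S (Fx p_pr) -> S (Fy p_pr) -> forall a, S a.
Proof.
move=> [S1 SM SL _] Sx Sy.
have SX (a : F) n : S a -> S (a ^+ n).
  by move=> Sa; elim: n => [|n IHn]; rewrite ?expg0 // expgS; exact: SM.
have carry1 n : ((n.+1 %/ p)%:R = (n %/ p)%:R + carry 1 n%:R :> 'F_p)%R.
  by have := carry_nat p_pr 1 n; rewrite add1n divn_small ?prime_gt1 // add0r => <-.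
have xX n : Fx p_pr ^+ n = (n%:R, 0, (n %/ p)%:R, 0, 0, 0)%R.
  elim: n => [|n IHn]; first by rewrite div0n.
  rewrite expgS IHn /mul /= carry0.
  by congr (_, _, _, _, _, _); rewrite ?carry1 -?[in RHS]natr1; ring.
have yX n : Fy p_pr ^+ n = (0, n%:R, 0, (n %/ p)%:R, 0, 0)%R.
  elim: n => [|n IHn]; first by rewrite div0n.
  rewrite expgS IHn /mul /= carry0.
  by congr (_, _, _, _, _, _); rewrite ?carry1 -?[in RHS]natr1; ring.
have nat_digits (a b : 'F_p) : exists n, n%:R%R = a /\ (n %/ p)%:R%R = b.
  exists (b * p + a)%N; rewrite divnMDl ?prime_gt0 // divn_small ?addn0; last first.
    by rewrite -[X in (_ < X)%N](Fp_cast p_pr).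
  by rewrite natrD natrM pchar_Fp_0 // mulr0 add0r !natr_Zp.
have S13 a1 a3 : S (a1, 0, a3, 0, 0, 0)%R.
  by have [n [<- <-]] := nat_digits a1 a3; rewrite -xX; exact: SX.
have S24 a2 a4 : S (0, a2, 0, a4, 0, 0)%R.
  by have [n [<- <-]] := nat_digits a2 a4; rewrite -yX; exact: SX.
have Sassoc a b c : S a -> S b -> S c -> S (Floop_emb (Floop_assoc a b c)).
  move=> Sa Sb Sc; rewrite -[Floop_emb _](loop_mulKl (a * (b * c))) -Floop_assocE.
  by apply: (SL); apply: (SM) => //; apply: (SM).
have S5 (a5 : 'F_p) : S (0, 0, 0, 0, a5, 0)%R.
  have := Sassoc _ _ _ Sx Sx (S24 a5 0%R).
  by rewrite /= !(mul1r, mul0r, subr0, mulr0).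
have S6 (a6 : 'F_p) : S (0, 0, 0, 0, 0, a6)%R.
  have := Sassoc _ _ _ (S13 a6 0%R) Sy Sy.
  by rewrite /= !(mul1r, mul0r, subr0, mulr0, mulr1).
move=> [[[[[a1 a2] a3] a4] a5] a6].
pose q13 : F := (a1, 0, a3, 0, 0, 0)%R; pose q24 : F := (0, a2, 0, a4, 0, 0)%R.
pose q5 : F := (0, 0, 0, 0, a5, 0)%R; pose q6 : F := (0, 0, 0, 0, 0, a6)%R.
have <- : q13 * q24 * (q5 * q6) = (a1, a2, a3, a4, a5, a6).
  by rewrite /mul /= !(addr0, add0r, carryC _ 0%R, carry0); congr (_, _, _, _, _, _); ring.
by apply: (SM); apply: (SM); [exact: S13 | exact: S24 | exact: S5 | exact: S6].
Qed.

End FloopExt.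

(** * Homomorphisms from F_p *)

Section FloopMorphisms.
Variables (p : nat) (p_pr : prime p).
Local Notation F := (Floop p_pr).
Local Notation x := (Fx p_pr).
Local Notation y := (Fy p_pr).

Lemma Floop_morph_eq (Q : loopType) (f g : {multiplicative F -> Q}) :
  f x = g x -> f y = g y -> f =1 g.
Proof.
by move=> fx fy; apply: Floop_generated => //; exact: subloop_equalizer.
Qed.

(** The right-hand side is additive as well and agrees with d on the generators.
    In particular an additive map to an elementary abelian p-group vanishes on the
    centre. *)
Lemma Floop_additive (U : lmodType 'F_p) (d : F -> U) :
    (forall a b, d (a * b) = (d a + d b)%R) ->
  forall a, d a = (coord1 a *: d x + coord2 a *: d y)%R.
Proof.
move=> dM; pose e (a : F) := (coord1 a *: d x + coord2 a *: d y)%R.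
have eM a b : e (a * b) = (e a + e b)%R.
  by rewrite /e coord1M coord2M !scalerDl addrACA.
apply: (@Floop_generated _ _ [set a | d a = e a]).
- split=> [|a b /= da db|a b /= da db|a b /= da db].
  + by apply: (addrI (d 1)); rewrite -dM mulg1 /e /= !scale0r !addr0.
  + by rewrite dM eM da db.
  + by apply: (addrI (d a)); rewrite -dM da -eM !loop_ldivKl.
  + by apply: (addIr (d b)); rewrite -dM db -eM !(loop_rdivKr b).
- by rewrite /= /e /= scale1r scale0r addr0.
- by rewrite /= /e /= scale1r scale0r add0r.
Qed.

Lemma Floop_proj_morph (h : {multiplicative F -> F}) a :
  Floop_proj (h a) = (coord1 a *: Floop_proj (h x) + coord2 a *: Floop_proj (h y))%R.
Proof.
have dM b c : Floop_proj (h (b * c)) = (Floop_proj (h b) + Floop_proj (h c))%R.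
  by rewrite gmulfM Floop_projM.
exact: (@Floop_additive (Fp2 p) (fun b => Floop_proj (h b)) dM).
Qed.

(** The two endomorphisms differ by a central factor, which depends additively on
    the argument and therefore is trivial on the centre. *)
Lemma Floop_morph_center (g h : {multiplicative F -> F}) :
    Floop_proj (g x) = Floop_proj (h x) -> Floop_proj (g y) = Floop_proj (h y) ->
  forall a, center F a -> g a = h a.
Proof.
move=> ghx ghy.
have diff a : exists v, h a = g a * Floop_emb p_pr v.
  have [v v_def] : exists v, ldiv (g a) (h a) = Floop_emb p_pr v.
    apply: Floop_proj_ker; apply: (addrI (Floop_proj (g a)));
    rewrite addr0 -Floop_projM loop_ldivKl.
    by rewrite (Floop_proj_morph h a) (Floop_proj_morph g a) ghx ghy.
  by exists v; rewrite -v_def loop_ldivKl.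
pose d (a : F) := projT1 (cid (diff a)).
have hE a : h a = g a * Floop_emb p_pr (d a) by rewrite /d; case: cid.
have dM a b : d (a * b) = (d a + d b)%R.
  apply: (@mul_emb_inj _ _ _ _ (Floop_ext p_pr) (g a * g b)) => /=.
  by rewrite -(mul_emb (Floop_ext p_pr)) /= -!hE -!gmulfM -hE.
move=> a /center_Floop [a1 a2].
by rewrite hE (Floop_additive dM) a1 a2 !scale0r addr0; symmetry; exact: mulg1.
Qed.

Definition row_loop (M : 'M['F_p]_2) (i : 'I_2) : F :=
  (M i 0%R, M i 1%R, 0, 0, 0, 0)%R.

(** Let h and g be the endomorphisms given by M and its inverse.  Then g h has the
    same linear part as the identity, so it fixes the centre pointwise, and an
    element of the kernel of h is central. *)
Lemma hat_exists (M : 'M['F_p]_2) : M \in unitmx ->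
  exists h : {multiplicative F -> F},
    [/\ bijective h, h x = row_loop M 0%R & h y = row_loop M 1%R].
Proof.
move=> unitM.
have [h [hx hy]] := Floop_free p_pr (Floop_ext p_pr) (row_loop M 0%R) (row_loop M 1%R).
have [g [gx gy]] := Floop_free p_pr (Floop_ext p_pr)
  (row_loop (invmx M) 0%R) (row_loop (invmx M) 1%R).
exists h; split=> //; apply: injF_bij.
have MVM i j : (M i 0 * invmx M 0 j + M i 1 * invmx M 1 j = (i == j)%:R)%R.
  have /matrixP/(_ i j) := mulmxV unitM; rewrite !mxE !big_ord_recl big_ord0 addr0.
  by rewrite (_ : lift ord0 ord0 = 1%R) //; exact/val_inj.
have gh_pi i : Floop_proj (g (row_loop M i)) = ((i == 0)%:R, (i == 1)%:R)%R :> Fp2 p.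
  by rewrite Floop_proj_morph gx gy; congr (_, _); exact: MVM.
pose gh : {multiplicative F -> F} := g \o h.
apply: loop_morph_inj => a ha1.
have gha1 : gh a = 1 by rewrite /= ha1; exact: loop_morph1.
have ghx : Floop_proj (gh x) = Floop_proj (idfun x) by rewrite /= hx gh_pi.
have ghy : Floop_proj (gh y) = Floop_proj (idfun y) by rewrite /= hy gh_pi.
have ca : center F a.
  apply/center_Floop.
  by have := Floop_proj_morph gh a; rewrite ghx ghy -(Floop_proj_morph idfun) gha1 => <-.
by rewrite -gha1 (Floop_morph_center ghx ghy ca).
Qed.

End FloopMorphisms.

(** * Loops of the class as quotients of F_p *)

Section ClassA.
Variables (p : nat) (p_pr : prime p).

(** Writing T for the inner mapping z |-> (xy)\(x(yz)), one has z = T(z) A(x,y,z);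
    multiplicativity of T is additivity of A(x,y,-).  Triviality of A modulo the
    central subloop holds because the quotient is a group. *)
Lemma class_A_ext (Q : loopType) : in_class_A p Q ->
  exists E : trilinear_ext Q (('F_p)^o : lmodType 'F_p) (Fp2 p),
    forall w, exists q, proj E q = w.
Proof.
move=> [_ QC Qaut [Z [cZ [[f [f' fK f'K]] [g [g' gK g'K]]]]]].
pose i (v : ('F_p)^o) : Q := val (f' v).
have iZ v : Z (i v) by exact: set_mem (valP (f' v)).
have iC v : center Q (i v) by apply: (proj2 cZ).
have iD u v : i (u + v)%R = i u * i v.
  have f'D : f' (u + v)%R = f' u * f' v by apply: (can_inj fK); rewrite gmulfM !f'K.
  exact: (congr1 val f'D).
have i_inj : injective i by move=> u v /val_inj /(can_inj f'K).
pose coset q : quotient_type cZ :=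
  exist _ (zcoset Z q) (mem_set (imageT (zcoset Z) q)).
have [Z1 ZM _ _] := proj1 cZ.
have cosetM q r : coset (q * r) = coset q * coset r.
  apply: val_inj => /=; apply/seteqP; split=> [_ [z Zz <-]|].
    exists (q * 1); first by exists 1.
    exists (r * z); first by exists z.
    by rewrite mulg1; have [_ _ _ ->] := proj2 cZ _ Zz q r.
  move=> _ [_ [u Zu <-] [_ [v Zv <-] <-]]; exists (u * v); first exact: ZM.
  by symmetry; apply: mul_center; exact: (proj2 cZ).
pose pi q : Fp2 p := g (coset q).
have piM q r : pi (q * r) = (pi q + pi r)%R by rewrite /pi cosetM gmulfM.
have pi1 : pi 1 = 0%R by apply: (addrI (pi 1)); rewrite -piM mulg1 addr0.
have pi_ker q : pi q = 0%R -> exists v, q = i v.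
  rewrite -pi1 => /(can_inj gK) /(congr1 val) /= q1.
  have Zq : Z q.
    have [z Zz <-] : zcoset Z 1 q by rewrite -q1; exists 1; rewrite ?mulg1.
    by rewrite mul1g.
  exists (f (exist _ q (mem_set Zq))).
  by rewrite /i fK.
have assoc_ex x y z : exists v, (x * y) * z = (x * (y * z)) * i v.
  have [v v_def] : exists v, ldiv (x * (y * z)) (x * y * z) = i v.
    apply: pi_ker; apply: (addrI (pi (x * (y * z)))); rewrite addr0 -piM loop_ldivKl.
    by rewrite !piM addrA.
  by exists v; rewrite -v_def loop_ldivKl.
pose A x y z := projT1 (cid (assoc_ex x y z)).
have AE x y z : (x * y) * z = (x * (y * z)) * i (A x y z) by rewrite /A; case: cid.
have AD x y z t : A x y (z * t) = (A x y z + A x y t)%R.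
  have [_ th_morph] := Qaut _ (inner_L y x).
  set th := fun z : Q => ldiv (x * y) (x * (y * z)) in th_morph.
  have thE s : s = th s * i (A x y s).
    apply: (@loop_mulIl _ (x * y)); rewrite AE.
    by have [_ _ _ ->] := iC (A x y s) (x * y) (th s); rewrite loop_ldivKl.
  apply: i_inj; apply: (@loop_mulIl _ (th (z * t))); rewrite -thE iD.
  by rewrite th_morph -mul_center // -!thE.
exists (TrilinearExt QC iD i_inj iC piM pi_ker AE AD) => w.
have [q qE] : exists q, g' w = coset q.
  have [q _ qE] := set_mem (valP (g' w)).
  by exists q; apply: val_inj.
by exists q; rewrite /= /pi -qE g'K.
Qed.

Theorem class_A_cover (Q : loopType) : in_class_A p Q ->
  exists phi : {multiplicative Floop p_pr -> Q},
    epimorphism phi /\ loop_ker phi `<=` center (Floop p_pr).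
Proof.
move=> QA; have [E pi_surj] := class_A_ext QA.
have [[x [y gen]] _ _ _] := QA.
have [phi [phix phiy]] := Floop_free p_pr E x y.
have phi_epi : epimorphism phi.
  move=> q; have [||a _ <-] := generated_ind gen (subloop_range phi) _ _ q.
  - by exists (Fx p_pr).
  - by exists (Fy p_pr).
  - by exists a.
exists phi; split=> // a phia; apply/center_Floop.
pose d (b : Floop p_pr) := proj E (phi b).
have dM b c : d (b * c) = (d b + d c)%R by rewrite /d gmulfM projM.
(* [lin] is the map induced by [phi] between the quotients by the centre and by
   the chosen central subloop; both have p^2 elements, so onto implies injective. *)
pose lin (k : 'F_p * 'F_p) : Fp2 p :=
  (k.1 *: d (Fx p_pr) + k.2 *: d (Fy p_pr))%R.
have lin_surj w : exists k, lin k = w.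
  have [q qE] := pi_surj w; have [b bE] := phi_epi q.
  by exists (coord1 b, coord2 b); rewrite -qE -bE; symmetry; exact: (Floop_additive dM).
pose s w := projT1 (cid (lin_surj w)).
have sK : cancel s lin by move=> w; rewrite /s; case: cid.
have s_bij : bijective s := @injF_bij ('F_p * 'F_p)%type s (can_inj sK).
have linK : cancel lin s by apply/(bij_can_sym s_bij).
have lin0 : lin (0, 0)%R = 0%R by rewrite /lin !scale0r addr0.
have : lin (coord1 a, coord2 a) = lin (0, 0)%R.
  rewrite lin0 -[LHS](Floop_additive dM) /d (phia : phi a = 1).
  by apply: (addrI (proj E 1)); rewrite addr0 -projM mulg1.
by move=> /(can_inj linK) [a1 a2]; rewrite /Floop_proj a1 a2.
Qed.

End ClassA.

(** * The isomorphism criterion *)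

Section Isomorphism.
Variables (p : nat) (p_pr : prime p) (Q1 Q2 : loopType).
Local Notation F := (Floop p_pr).
Variables (phi1 : {multiplicative F -> Q1}) (phi2 : {multiplicative F -> Q2}).
Hypotheses (epi1 : epimorphism phi1) (epi2 : epimorphism phi2).
Hypothesis ker1 : loop_ker phi1 `<=` center F.
Hypothesis ker2 : loop_ker phi2 `<=` center F.

Lemma isomorphic_of_hat (h : F -> F) : automorphism h ->
  loop_ker phi2 = h @` loop_ker phi1 -> isomorphic Q1 Q2.
Proof.
move=> [h_bij hM] kerE; pose hm := mk_multiplicative hM.
have h_inj := bij_inj h_bij; have [h' h'K hK] := h_bij.
have phi2_h a b : phi1 a = phi1 b -> phi2 (hm a) = phi2 (hm b).
  move=> /loop_morph_eqE kab; rewrite -[in RHS](loop_ldivKl a b) !gmulfM.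
  have : loop_ker phi2 (hm (ldiv a b)) by rewrite kerE; exists (ldiv a b).
  by rewrite /loop_ker /= => ->; rewrite mulg1.
pose s q := projT1 (cid (epi1 q)); have sK q : phi1 (s q) = q by rewrite /s; case: cid.
pose f q := phi2 (hm (s q)).
have fE a : f (phi1 a) = phi2 (hm a) by apply: phi2_h; rewrite sK.
have fM : {morph f : q r / q * r}.
  by move=> q r; rewrite -[q]sK -[r]sK -gmulfM !fE !gmulfM.
apply: (@inj_epi_isomorphic _ _ (mk_multiplicative fM)).
  apply: loop_morph_inj => q /=; rewrite -[q]sK fE => kq.
  have : loop_ker phi2 (hm (s q)) by [].
  by rewrite kerE => -[a ka /h_inj <-].
by move=> q; have [a <-] := epi2 q; exists (phi1 (h' a)); rewrite /= fE /= hK.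
Qed.

(** The lift h of the isomorphism has some linear part M.  Its rows span the plane
    because f phi1 is onto and ker phi2 is central.  The automorphism with linear
    part M agrees with h on the centre, hence on both kernels. *)
Lemma hat_of_isomorphic : isomorphic Q1 Q2 ->
  exists (rho : {'GL_2(p)}) (rho_hat : F -> F),
    is_hat rho rho_hat /\ loop_ker phi2 = rho_hat @` loop_ker phi1.
Proof.
move=> [f f_bij]; have f_inj := bij_inj f_bij; have [f' f'K fK] := f_bij.
have [a aE] := epi2 (f (phi1 (Fx p_pr))).
have [b bE] := epi2 (f (phi1 (Fy p_pr))).
have [h [hx hy]] := Floop_free p_pr (Floop_ext p_pr) a b.
have phi2h c : phi2 (h c) = f (phi1 c).
  apply: (@Floop_morph_eq _ p_pr _ (phi2 \o h) (f \o phi1)) => /=.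
    by rewrite hx.
  by rewrite hy.
(* The rows of M are the linear parts of h x = a and h y = b. *)
pose M : 'M['F_p]_2 := (\matrix_(i, j)
  if i == 0 then if j == 0 then coord1 a else coord2 a
  else if j == 0 then coord1 b else coord2 b)%R.
have M_surj (u1 u2 : 'F_p) : exists k l : 'F_p,
    (k * coord1 a + l * coord1 b = u1 /\ k * coord2 a + l * coord2 b = u2)%R.
  pose e : F := (u1, u2, 0, 0, 0, 0)%R.
  have [q qE] := epi1 (f' (phi2 e)).
  have hq_e : phi2 (h q) = phi2 e by rewrite phi2h qE fK.
  have /ker2/center_Floop d0 := loop_morph_eqE hq_e.
  have pi_e : Floop_proj e = (coord1 q *: Floop_proj a + coord2 q *: Floop_proj b)%R.
    by rewrite -hx -hy -Floop_proj_morph -(loop_ldivKl (h q) e) Floop_projM d0 addr0.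
  exists (coord1 q), (coord2 q).
  by split; [exact/esym/(congr1 fst pi_e) | exact/esym/(congr1 snd pi_e)].
have [k0 [l0 [e00 e01]]] := M_surj 1%R 0%R.
have [k1 [l1 [e10 e11]]] := M_surj 0%R 1%R.
have unitM : M \in unitmx.
  pose U : 'M['F_p]_2 := (\matrix_(i, j)
    if i == 0 then if j == 0 then k0 else l0 else if j == 0 then k1 else l1)%R.
  have UM : (U *m M = 1%:M)%R.
    apply/matrixP => i j; rewrite !mxE !big_ord_recl big_ord0 addr0 !mxE /=.
    by case: i j => [[|[|]] //= ?] [[|[|]] //= ?].
  by have [] := mulmx1_unit UM.
have [k [k_bij kx ky]] := hat_exists p_pr unitM.
pose rho : {'GL_2(p)} := FinRing.Unit unitM.
have kh c : center F c -> k c = h c.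
  by apply: Floop_morph_center; rewrite ?kx ?ky ?hx ?hy /Floop_proj /row_loop /= !mxE.
exists rho, k; split; first by split=> //; split=> //; exact: gmulfM.
apply/seteqP; split=> [c kc|_ [c kc <-]].
  have [k' k'K kK] := k_bij.
  have cc : center F (k' c).
    by apply: (center_inj_morph (bij_inj k_bij)); rewrite kK; exact: ker2.
  exists (k' c) => //; apply: f_inj.
  by rewrite loop_morph1 -phi2h -kh // kK; exact: kc.
by rewrite /loop_ker /= (kh _ (ker1 kc)) phi2h (kc : phi1 c = 1) loop_morph1.
Qed.

End Isomorphism.

Theorem theorem4p2 (p : nat) (p_pr : prime p) :
  (forall Q : loopType, in_class_A p Q ->
     exists phi : {multiplicative Floop p_pr -> Q},
       epimorphism phi /\ loop_ker phi `<=` center (Floop p_pr)) /\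
  (forall (Q1 Q2 : loopType), in_class_A p Q1 -> in_class_A p Q2 ->
     forall (phi1 : {multiplicative Floop p_pr -> Q1})
            (phi2 : {multiplicative Floop p_pr -> Q2}),
       epimorphism phi1 -> loop_ker phi1 `<=` center (Floop p_pr) ->
       epimorphism phi2 -> loop_ker phi2 `<=` center (Floop p_pr) ->
       (isomorphic Q1 Q2 <->
        exists (rho : {'GL_2(p)}) (rho_hat : Floop p_pr -> Floop p_pr),
          is_hat rho rho_hat /\ loop_ker phi2 = rho_hat @` loop_ker phi1)).
Proof.
split; first exact: class_A_cover.
move=> Q1 Q2 _ _ phi1 phi2 epi1 ker1 epi2 ker2; split.
  exact: hat_of_isomorphic.
by move=> [rho [h [[h_aut _ _] kerE]]]; exact: isomorphic_of_hat h_aut kerE.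
Qed.
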